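(* There exists a positive absolute constant $C$ such that the following holds. Let $G$ be a finite group with $|G|\ge2$, let $\alpha\in[0,1)$, and let $\mu$ be a probability measure on $G$ such that the transition matrix $P_\mu(x,y)=\mu(x^{-1}\cdot y)$, $x,y\in G$, is irreducible and aperiodic. If $\mu$ is symmetric, i.e. $\mu(g)=\mu(g^{-1})$ for all $g\in G$, then for any $\varepsilon\in(0,1)$ the $\varepsilon$-mixing time of the SRRW on $G$ with step distribution $\mu$ and reinforcement parameter $\alpha$ satisfies $$t^{(\alpha)}_{\mathrm{mix}}(\varepsilon)\le\frac{C}{1-\alpha}\log\left(\frac{|G|}{\varepsilon}\right)\frac1{\gamma_*},$$ where $\gamma_*=1-\lambda_*$ is the absolute spectral gap of $P_\mu$, with $\lambda_*=\max\{|\lambda|:\lambda\in\operatorname{spec}(P_\mu),\ \lambda\ne1\}$. (The constant $C$ does not depend on $G,\mu,\alpha,\varepsilon$.)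
   Context: SRRW: Let $(G,\cdot)$ be a discrete group with $|G|\ge2$ and identity $e_G$, $\mu$ a probability measure on $G$, and $\alpha\in[0,1)$. Let $(\xi_n)_{n\ge2}$ be i.i.d. Bernoulli random variables with $\mathbb{P}(\xi_n=1)=\alpha$, and let $(u_n)_{n\ge2}$ be independent with $u_n$ uniform on $\{1,\dots,n-1\}$; these two sequences and all fresh samples from $\mu$ below are independent. Set $S_0=e_G$; sample $X_1$ from $\mu$ and set $S_1=X_1$. For $n>1$: if $\xi_n=1$ set $X_n=X_{u_n}$; if $\xi_n=0$ sample $X_n$ afresh from $\mu$; put $S_n=S_{n-1}\cdot X_n$. The process $(S_n)$ is the SRRW on $G$ (started at $e_G$) with step distribution $\mu$ and reinforcement parameter $\alpha$. Mixing time: with $U$ the uniform measure on the finite group $G$ and $\|\nu_1-\nu_2\|_{\mathrm{TV}}=\frac12\sum_{g\in G}|\nu_1(g)-\nu_2(g)|$, $$t^{(\alpha)}_{\mathrm{mix}}(\varepsilon)=\inf\{n\ge1:\ \|\mathbb{P}(S_m=\cdot)-U\|_{\mathrm{TV}}\le\varepsilon\ \text{ for all } m\ge n\}.$$ $\operatorname{spec}(P_\mu)$ denotes the spectrum of the matrix $P_\mu$. *)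

(* Defs.v *)
From HB Require Import structures.
From mathcomp Require Import all_boot all_order all_fingroup all_algebra.
From mathcomp Require Import all_classical all_reals all_analysis.
From mathcomp Require Import complex.

Set Implicit Arguments.
Unset Strict Implicit.
Unset Printing Implicit Defensive.

Import Order.TTheory GRing.Theory Num.Theory.
Import numFieldNormedType.Exports.

Local Open Scope classical_set_scope.
Local Open Scope ring_scope.

Definition is_pmf (R : realType) (T : finType) (mu : T -> R) : Prop :=
  (forall x, 0 <= mu x) /\ \sum_x mu x = 1.

Definition symmetric_pmf (R : realType) (gT : finGroupType) (mu : gT -> R)
  : Prop := forall g, mu g = mu (g^-1)%g.

Definition transition_mx (R : realType) (gT : finGroupType) (mu : gT -> R)
  : 'M[R]_#|gT| :=
  \matrix_(i, j) mu ((enum_val i)^-1 * enum_val j)%g.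

Definition irreducible_mx (R : realType) (n : nat) (P : 'M[R]_n) : Prop :=
  forall i j, exists k : nat, 0 < (P ^+ k) i j.

(* For every state i, 1 is the only common divisor of the return times
   { k >= 1 : P^k(i, i) > 0 }. *)
Definition aperiodic_mx (R : realType) (n : nat) (P : 'M[R]_n) : Prop :=
  forall i (d : nat),
    (forall k : nat, (0 < k)%N -> 0 < (P ^+ k) i i -> (d %| k)%N) -> d = 1%N.

Definition spectrum (R : realType) (n : nat) (P : 'M[R]_n) : set R[i] :=
  [set l | eigenvalue (map_mx (real_complex R) P) l].

(* The spectrum is finite, so the supremum is a maximum as soon as there is an
   eigenvalue other than 1; otherwise its value is 0. *)
Definition lambda_star (R : realType) (n : nat) (P : 'M[R]_n) : R :=
  sup [set ComplexField.Normc.normc l | l in spectrum P `\ (1 : R[i])].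

Definition absolute_gap (R : realType) (n : nat) (P : 'M[R]_n) : R :=
  1 - lambda_star P.

(* Measurability of f with respect to the discrete sigma-algebra on T. *)
Definition discrete_rv d (Omega : measurableType d) (T : Type)
  (f : Omega -> T) : Prop := forall A : set T, measurable (f @^-1` A).

Definition mutually_independent d (Omega : measurableType d) (R : realType)
  (Pr : probability Omega R) (I : eqType) (T : I -> Type)
  (f : forall i, Omega -> T i) : Prop :=
  (forall i, discrete_rv (f i)) /\
  forall (s : seq I) (A : forall i, set (T i)), uniq s ->
    Pr (\bigcap_(i in [set` s]) (f i @^-1` A i)) =
    (\prod_(i <- s) Pr (f i @^-1` A i))%E.

(* The family consisting of all xi_n (n >= 2), all u_n (n >= 2) and all
   eta_n (n >= 1), indexed by nat + nat + nat. *)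
Definition srrw_value (G : Type) (i : nat + nat + nat) : Type :=
  match i with
  | inl (inl _) => bool
  | inl (inr _) => nat
  | inr _ => G
  end.

Definition srrw_family (G Omega : Type) (xi : nat -> Omega -> bool)
  (u : nat -> Omega -> nat) (eta : nat -> Omega -> G) (i : nat + nat + nat)
  : Omega -> srrw_value G i :=
  match i with
  | inl (inl k) => xi k.+2
  | inl (inr k) => u k.+2
  | inr k => eta k.+1
  end.

(* eta n is the fresh sample from mu available at step n; it is used at step 1
   and at the steps n >= 2 for which xi n is false. *)
Record srrw_randomness d (Omega : measurableType d) (R : realType)
  (Pr : probability Omega R) (gT : finGroupType) (mu : gT -> R) (alpha : R)
  (xi : nat -> Omega -> bool) (u : nat -> Omega -> nat)
  (eta : nat -> Omega -> gT) : Prop := {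
  srrw_independent : mutually_independent Pr (srrw_family xi u eta);
  srrw_xi_law : forall n, (2 <= n)%N -> Pr [set w | xi n w] = alpha%:E;
  srrw_u_range : forall n w, (2 <= n)%N -> (1 <= u n w < n)%N;
  srrw_u_law : forall n k, (2 <= n)%N -> (1 <= k < n)%N ->
    Pr [set w | u n w = k] = ((n.-1)%:R^-1)%:E;
  srrw_eta_law : forall n g, (1 <= n)%N ->
    Pr [set w | eta n w = g] = (mu g)%:E
}.

Definition is_srrw d (Omega : measurableType d) (R : realType)
  (Pr : probability Omega R) (gT : finGroupType) (mu : gT -> R) (alpha : R)
  (S : nat -> Omega -> gT) : Prop :=
  exists (xi : nat -> Omega -> bool) (u : nat -> Omega -> nat)
         (eta X : nat -> Omega -> gT),
    [/\ srrw_randomness Pr mu alpha xi u eta,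
        forall w, X 1%N w = eta 1%N w,
        forall n w, (2 <= n)%N ->
          X n w = if xi n w then X (u n w) w else eta n w,
        forall w, S 0%N w = 1%g
      & forall n w, S n.+1 w = (S n w * X n.+1 w)%g].

Definition tv_dist (R : realType) (T : finType) (nu1 nu2 : T -> R) : R :=
  2^-1 * \sum_x `|nu1 x - nu2 x|.

Definition uniform_pmf (R : realType) (T : finType) : T -> R :=
  fun=> #|T|%:R^-1.

Definition law d (Omega : measurableType d) (R : realType)
  (Pr : probability Omega R) (T : finType) (f : Omega -> T) : T -> R :=
  fun x => fine (Pr [set w | f w = x]).

(* The infimum of the empty set is +oo. *)
Definition mixing_time d (Omega : measurableType d) (R : realType)
  (Pr : probability Omega R) (T : finType) (S : nat -> Omega -> T) (eps : R)
  : \bar R :=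
  ereal_inf [set (n%:R)%:E | n in [set n : nat | (1 <= n)%N /\
    forall m, (n <= m)%N ->
      tv_dist (law Pr (S m)) (@uniform_pmf R T) <= eps]].

(* Main.v *)
Require Import Defs.
From HB Require Import structures.
From mathcomp Require Import all_boot all_order all_fingroup all_algebra.
From mathcomp Require Import all_classical all_reals all_analysis.
From mathcomp Require Import complex.
From mathcomp Require Import spectral ring lra.

Set Implicit Arguments.
Unset Strict Implicit.
Unset Printing Implicit Defensive.

Import Order.TTheory GRing.Theory Num.Theory.
Import numFieldNormedType.Exports.

Local Open Scope classical_set_scope.
Local Open Scope ring_scope.

(** Unfolding the reinforcement, every step of the walk uses one of the fresh
    samples: S_n is the product of eta over a random list of n labels, and the
    list depends only on the coins xi and the choices u, which are independent
    of the samples.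

    Fix the list of labels.  A sample whose label occurs exactly once in the
    list is independent of all the other factors of the product.  Average over
    these samples first and freeze the others: the law of the product becomes a
    mixture of products of matrices, each of them either a translation or
    P = transition_mx mu, with one factor P per singleton label
    (average_singletons).  On row vectors of sum zero, translations are
    isometries for the Euclidean norm and, P being symmetric, the spectral
    theorem makes P a contraction of ratio lambda_star P (sqnorm_contract).
    Applied to the Dirac mass at 1 minus the uniform law, this bounds the total
    variation distance by (|G| / 2) * lambda_star ^ K, where K is the number of
    singleton labels (word_law_near_uniform).

    It remains to bound the mean f_n of theta ^ K over the lists of length n,
    where theta = 1 - gamma / 2 lies between lambda_star and 1 and is at least
    1/2.  A new step creates a singleton with probability 1 - alpha and destroys
    one with probability alpha * K / n.  The loss term contains
    K * theta ^ K, a concave function of theta ^ K up to a constant;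
    replacing it by a tangent line (power_tangent) gives a linear
    recursion for f_n, whose solution decays like exp (- a * n / 4) with
    a = (1 - alpha) * (1 - theta) (genealogy_mean_singletons).  Because the
    tangent point moves with n, no large deviation estimate for K is needed, and
    no factor depending on alpha alone is lost.

    Hence the distance at time n is at most
    (|G| / 2) * exp (1 - (1 - alpha) * gamma * n / 8).  Since
    log (|G| / eps) >= log 2 >= 1/2, the additive constant and the rounding of
    n to an integer are absorbed in the constant of the theorem. *)

(** * Contraction by a symmetric irreducible aperiodic kernel *)

Definition sqnorm (R : realType) n (v : 'rV[R]_n) : R := \sum_j v 0 j ^+ 2.

Section MaximumPrinciple.
Variables (R : realType) (n : nat) (Q : 'M[R]_n) (f : 'rV[R]_n) (c : R).
Hypothesis Q_ge0 : forall i j, 0 <= Q i j.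
Hypothesis Q_col : forall j, \sum_i Q i j = 1.
Hypothesis f_eig : f *m Q = c *: f.

Lemma eigenvector_entry x : \sum_y f 0 y * Q y x = c * f 0 x.
Proof. by have := congr1 (fun M : 'rV_n => M 0 x) f_eig; rewrite !mxE. Qed.

Lemma eigenvalue_le1 x :
  (forall y, `|f 0 y| <= `|f 0 x|) -> f 0 x != 0 -> `|c| <= 1.
Proof.
move=> fx_max fx0.
rewrite -(@ler_pM2r _ `|f 0 x|) ?normr_gt0// mul1r -normrM -eigenvector_entry.
rewrite (le_trans (ler_norm_sum _ _ _))//.
rewrite -[leRHS]mul1r -(Q_col x) mulr_suml ler_sum// => y _.
by rewrite normrM (ger0_norm (Q_ge0 _ _)) mulrC ler_wpM2l.
Qed.

(** The equality case of the triangle inequality.  At a point x where |f| is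
    maximal, the Q-average of the nonnegative numbers
    f(x)^2 - c * f(x) * f(z) is f(x)^2 - c^2 * f(x)^2 = 0, so each of them
    vanishes where Q puts mass. *)
Lemma eigenvector_extremal x y :
  (forall z, `|f 0 z| <= `|f 0 x|) -> c ^+ 2 = 1 -> 0 < Q y x ->
  f 0 y = c * f 0 x.
Proof.
move=> fx_max c2 Qyx.
have [fx0|fx0] := eqVneq (f 0 x) 0.
  have := fx_max y; rewrite fx0 normr0 normr_le0 => /eqP ->.
  by rewrite mulr0.
have c1 : `|c| = 1.
  by apply/eqP; rewrite -sqrp_eq1// real_normK ?num_real ?c2.
have ge0 z : 0 <= Q z x * (f 0 x ^+ 2 - c * f 0 x * f 0 z).
  rewrite mulr_ge0// subr_ge0 (le_trans (ler_norm _))// !normrM c1 mul1r.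
  rewrite -[f 0 x ^+ 2]ger0_norm ?sqr_ge0// normrX expr2.
  by rewrite ler_wpM2l.
have sum0 : \sum_z Q z x * (f 0 x ^+ 2 - c * f 0 x * f 0 z) = 0.
  transitivity (\sum_z (Q z x * f 0 x ^+ 2 - (c * f 0 x) * (f 0 z * Q z x))).
    by apply: eq_bigr => z _; ring.
  rewrite sumrB -mulr_suml Q_col -mulr_sumr eigenvector_entry.
  transitivity (f 0 x ^+ 2 * (1 - c ^+ 2)); first by ring.
  by rewrite c2 subrr mulr0.
have /eqP := @psumr_eq0P _ _ xpredT _ (fun z _ => ge0 z) sum0 y isT.
rewrite mulf_eq0 gt_eqF//= subr_eq0 => /eqP /(congr1 ( *%R (c / f 0 x))).
have -> : c / f 0 x * f 0 x ^+ 2 = c * f 0 x by field.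
have -> : c / f 0 x * (c * f 0 x * f 0 y) = c ^+ 2 * f 0 y by field.
by rewrite c2 mul1r => ->.
Qed.
End MaximumPrinciple.

Section Spectral.
Variables (R : realType) (n : nat) (P : 'M[R]_n).
Hypothesis P_ge0 : forall i j, 0 <= P i j.
Hypothesis P_col : forall j, \sum_i P i j = 1.
Hypothesis P_irr : irreducible_mx P.
Hypothesis P_aper : aperiodic_mx P.
Hypothesis P_sym : P^T = P.
Local Notation C := R[i].
Local Notation toC := (real_complex R).
Local Notation PC := (map_mx toC P).

Lemma mxpow_ge0 k i j : 0 <= (P ^+ k) i j.
Proof.
elim: k i j => [|k IH] i j; first by rewrite expr0 mxE ler0n.
by rewrite exprS mxE sumr_ge0// => l _; rewrite mulr_ge0.
Qed.

Lemma mxpow_col_sum k j : \sum_i (P ^+ k) i j = 1.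
Proof.
elim: k j => [|k IH] j.
  rewrite expr0 (bigD1 j)//= mxE eqxx big1 ?addr0// => i ij.
  by rewrite mxE (negbTE ij).
rewrite exprS; under eq_bigr do rewrite mxE.
rewrite exchange_big/= -[RHS](IH j); apply: eq_bigr => l _.
by rewrite -mulr_suml P_col mul1r.
Qed.

Lemma mxpow_eigen (f : 'rV[R]_n) c k :
  f *m P = c *: f -> f *m P ^+ k = c ^+ k *: f.
Proof.
move=> fP; elim: k => [|k IH]; first by rewrite !expr0 mulmx1 scale1r.
by rewrite exprS mulmxA fP -scalemxAl IH scalerA -exprS.
Qed.

Lemma abs_argmax (f : 'rV[R]_n) (x0 : 'I_n) :
  exists x, forall y, `|f 0 y| <= `|f 0 x|.
Proof.
exists [arg max_(x > x0) `|f 0 x|]%O => y.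
by case: Order.TotalTheory.arg_maxP => // x _; apply.
Qed.

(** Irreducibility spreads the value at a maximum of |f| to every state: some
    power of P, for which f is still an eigenvector, charges the entry. *)
Lemma harmonic_const (f : 'rV[R]_n) x y : f *m P = f -> f 0 x = f 0 y.
Proof.
move=> fP; have [m m_max] := abs_argmax f x.
suff const z : f 0 z = f 0 m by rewrite !const.
have [k Pk] := P_irr z m.
have fPk : f *m P ^+ k = 1 *: f by rewrite (@mxpow_eigen f 1) ?expr1n ?scale1r.
by rewrite (eigenvector_extremal (mxpow_ge0 k) (mxpow_col_sum k) fPk m_max)
  ?mul1r ?expr1n.
Qed.

(** An eigenvalue -1 would make the eigenvector change sign at each step, so
    that returns to a maximum of |f| would only happen at even times, against
    aperiodicity. *)
Lemma real_eigenvalue_lt1 c : eigenvalue P c -> c != 1 -> `|c| < 1.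
Proof.
move=> /eigenvalueP [f fP f0] c1.
have [x0 _] : exists x, f 0 x != 0.
  apply: contrapT => nf; case/eqP: f0; apply/rowP => x; rewrite [RHS]mxE.
  by apply/eqP; apply: contrapT => /negP fx; apply: nf; exists x.
have [m m_max] := abs_argmax f x0.
have fm0 : f 0 m != 0.
  apply: contra f0 => /eqP fm; apply/eqP/rowP => x.
  by have := m_max x; rewrite fm normr0 normr_le0 mxE => /eqP.
have cle1 := eigenvalue_le1 P_ge0 P_col fP m_max fm0.
rewrite lt_neqAle cle1 andbT; apply/negP => /eqP abs1.
have c2 : c ^+ 2 = 1 by rewrite -[LHS]real_normK ?num_real// abs1 expr1n.
have cN1 : c = -1.
  by have /eqP := c2; rewrite sqrf_eq1 (negbTE c1) => /eqP.
(* All return times to m turn out to be even. *)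
suff : 2%N = 1%N by [].
apply: (P_aper (i := m)) => k _ Pk.
have ck2 : (c ^+ k) ^+ 2 = 1 by rewrite -exprM mulnC exprM c2 expr1n.
have := eigenvector_extremal (mxpow_ge0 k) (mxpow_col_sum k) (mxpow_eigen k fP)
  m_max ck2 Pk.
rewrite cN1 -signr_odd dvdn2; case: (odd k) => //=.
rewrite expr1 mulN1r => /eqP; rewrite -subr_eq0 opprK -mulr2n mulrn_eq0 /=.
by rewrite (negbTE fm0).
Qed.


(** The spectrum of P consists of complex numbers; over C the real symmetric
    matrix P is hermitian, which gives real eigenvalues and an orthonormal
    eigenbasis, the rows of U. *)
Lemma complexified_hermitian : PC \is hermsymmx.
Proof.
apply: realsym_hermsym.
  by apply/is_hermitianmxP; rewrite expr0 scale1r map_mx_id// map_trmx P_sym.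
by apply/mxOverP => i j; rewrite mxE complex_real.
Qed.

Local Notation U := (spectralmx PC).
Local Notation D := (spectral_diag PC).

Lemma spectral_real j : (complex.Re (D 0 j))%:C%C = D 0 j.
Proof.
have /mxOverP/(_ 0 j) := hermitian_spectral_diag_real complexified_hermitian.
exact: RRe_real.
Qed.

Lemma spectral_eq : U *m PC = diag_mx D *m U.
Proof.
have /orthomx_spectralP PE := hermitian_normalmx complexified_hermitian.
by rewrite {2}PE !mulmxA mulmxV ?spectral_unit// mul1mx.
Qed.

Lemma spectral_row j : row j U *m PC = D 0 j *: row j U.
Proof.
by rewrite -row_mul spectral_eq; apply/rowP => k; rewrite mul_diag_mx !mxE. Qed.

Lemma row_spectral_neq0 j : row j U != 0.
Proof.
apply/negP => /eqP rU0; have /unitarymxP := spectral_unitarymx PC.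
move=> /(congr1 (row j)); rewrite row_mul rU0 mul0mx.
move=> /rowP/(_ j); rewrite !mxE eqxx => /eqP.
by rewrite eq_sym oner_eq0.
Qed.

Lemma spectral_eigenvalue j : eigenvalue PC (D 0 j).
Proof.
apply/eigenvalueP; exists (row j U); [exact: spectral_row|exact: row_spectral_neq0].
Qed.

Lemma spectrum_spectral_diag l : spectrum P l -> exists j, l = D 0 j.
Proof.
rewrite /spectrum /= => /eigenvalueP [f fP f0].
have Uu := spectral_unit PC.
have gD : f *m invmx U *m diag_mx D = l *: (f *m invmx U).
  rewrite -[_ *m diag_mx D](mulmxK Uu) -(mulmxA _ _ U) -spectral_eq.
  by rewrite !mulmxA mulmxKV// fP -!scalemxAl.
have : f *m invmx U != 0.
  by apply: contra f0 => /eqP g0; rewrite -(mulmxKV Uu f) g0 mul0mx.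
move=> gn0; apply: contrapT => nl; case/eqP: gn0; apply/rowP => j.
rewrite [RHS]mxE; have := congr1 (fun M : 'rV_n => M 0 j) gD.
rewrite mul_mx_diag mxE [X in _ = X]mxE mulrC => /eqP.
rewrite -subr_eq0 -mulrBl mulf_eq0 => /orP[|/eqP->//].
by rewrite subr_eq0 => /eqP DE; case: nl; exists j.
Qed.

Lemma spectral_lt1 j : D 0 j != 1 -> ComplexField.Normc.normc (D 0 j) < 1.
Proof.
move=> D1; have := spectral_eigenvalue j; move: D1.
rewrite -spectral_real (eigenvalue_map (real_complex R)) => D1 ev.
rewrite /ComplexField.Normc.normc /= expr0n addr0 sqrtr_sqr.
by apply: real_eigenvalue_lt1 => //; apply: contra D1 => /eqP->.
Qed.

Local Notation moduli :=
  [set ComplexField.Normc.normc l | l in spectrum P `\ (1 : R[i])].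

Lemma moduli_ub : ubound moduli 1.
Proof.
move=> _ [l [/= /spectrum_spectral_diag [j ->] D1] <-].
by rewrite ltW// spectral_lt1//; apply/eqP.
Qed.

Lemma lambda_star_ge0 : 0 <= lambda_star P.
Proof.
rewrite /lambda_star; have [->|/set0P [x xS]] := eqVneq moduli set0.
  by rewrite sup0.
apply: (@le_trans _ _ x).
  by case: xS => l _ <-; case: l => a b; rewrite /= sqrtr_ge0.
by apply: ub_le_sup => //; exists 1; exact: moduli_ub.
Qed.

(** The supremum is dominated by a maximum over the finite family D of numbers
    smaller than 1, so it stays strictly below 1. *)
Lemma lambda_star_lt1 : lambda_star P < 1.
Proof.
pose m := \big[Num.max/0]_(j | D 0 j != 1) ComplexField.Normc.normc (D 0 j).
have m1 : m < 1 by apply/bigmax_ltP; split => // j; exact: spectral_lt1.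
rewrite /lambda_star; have [->|/set0P S0] := eqVneq moduli set0.
  by rewrite sup0.
apply: le_lt_trans m1; apply: ge_sup => //.
move=> _ [l [/= /spectrum_spectral_diag [j ->] D1] <-].
by apply: le_bigmax_cond; apply/eqP.
Qed.

Lemma spectral_le_lambda j :
  D 0 j != 1 -> ComplexField.Normc.normc (D 0 j) <= lambda_star P.
Proof.
move=> D1; apply: ub_le_sup; first by exists 1; exact: moduli_ub.
by exists (D 0 j) => //; split; [exact: spectral_eigenvalue|apply/eqP].
Qed.

(** The eigenvalue 1 only carries constants.  Maximum principles are real, so
    the real and imaginary parts of the eigenvector are treated separately. *)
Lemma spectral_const j x y : D 0 j = 1 -> U j x = U j y.
Proof.
move=> D1; have := spectral_row j; rewrite D1 scale1r.
have : forall z, U j z = row j U 0 z by move=> z; rewrite mxE.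
move: (row j U) => u uE uP.
have eqn z : \sum_y u 0 y * (P y z)%:C%C = u 0 z.
  have := congr1 (fun M : 'rV_n => M 0 z) uP; rewrite mxE => <-.
  by apply: eq_bigr => t _; rewrite [X in _ = _ * X]mxE.
rewrite !uE; apply/eqP; rewrite eq_complex; apply/andP; split; apply/eqP.
  have rP : (\row_z complex.Re (u 0 z)) *m P = \row_z complex.Re (u 0 z).
    apply/rowP => z; rewrite !mxE -[in RHS]eqn raddf_sum; apply: eq_bigr => t _.
    by rewrite mxE; case: (u 0 t) => a b /=; rewrite mulr0 subr0.
  by have := harmonic_const x y rP; rewrite !mxE.
have rP : (\row_z complex.Im (u 0 z)) *m P = \row_z complex.Im (u 0 z).
  apply/rowP => z; rewrite !mxE -[in RHS]eqn raddf_sum; apply: eq_bigr => t _.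
  by rewrite mxE; case: (u 0 t) => a b /=; rewrite mulr0 add0r.
by have := harmonic_const x y rP; rewrite !mxE.
Qed.

Lemma dotmx_sqnorm (v : 'rV[R]_n) :
  dotmx (map_mx toC v) (map_mx toC v) = (sqnorm v)%:C%C.
Proof.
rewrite dotmxE mxE rmorph_sum; apply: eq_bigr => j _.
by rewrite !mxE conj_Creal ?complex_real// -rmorphM expr2.
Qed.

Lemma dotmx_diag (w : 'rV[C]_n) : dotmx w w = \sum_j `|w 0 j| ^+ 2.
Proof.
by rewrite dotmxE mxE; apply: eq_bigr => j _; rewrite !mxE normCK.
Qed.

Lemma dotmx_unitary (w : 'rV[C]_n) : dotmx (w *m U) (w *m U) = dotmx w w.
Proof.
rewrite !dotmxE trmx_mul map_mxM !mulmxA -(mulmxA w).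
by rewrite (unitarymxP (spectral_unitarymx PC)) mulmx1.
Qed.

(** In the eigenbasis, the coordinates of v along eigenvalue 1 vanish, because
    these eigenvectors are constant and v has sum zero; every other coordinate is
    multiplied by an eigenvalue of modulus at most lambda_star P. *)
Lemma sqnorm_contract (v : 'rV[R]_n) : \sum_j v 0 j = 0 ->
  sqnorm (v *m P) <= lambda_star P ^+ 2 * sqnorm v.
Proof.
move=> v0; have Uu := spectral_unit PC.
pose w := map_mx toC v *m invmx U.
have vE : map_mx toC v = w *m U by rewrite mulmxKV.
have w0 j : D 0 j = 1 -> w 0 j = 0.
  move=> D1; rewrite /w invmx_unitary ?spectral_unitarymx// mxE.
  under eq_bigr => x _ do rewrite !mxE (spectral_const x j D1).
  by rewrite -mulr_suml -rmorph_sum v0 mul0r.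
suff : (sqnorm (v *m P))%:C%C <= (lambda_star P ^+ 2 * sqnorm v)%:C%C.
  by rewrite lecR.
rewrite -dotmx_sqnorm rmorphM /= -dotmx_sqnorm map_mxM vE -mulmxA spectral_eq.
rewrite mulmxA !dotmx_unitary !dotmx_diag mulr_sumr; apply: ler_sum => j _.
rewrite mul_mx_diag mxE normrM exprMn mulrC.
have [D1|D1] := eqVneq (D 0 j) 1; first by rewrite (w0 _ D1) normr0 expr0n !mulr0.
apply: ler_wpM2r; first by rewrite exprn_ge0.
rewrite rmorphXn /=; apply: lerXn2r; rewrite ?nnegrE ?normr_ge0//.
  by rewrite -[0]/(0%:C%C) lecR lambda_star_ge0.
have := spectral_le_lambda D1; rewrite -lecR; apply: le_trans.
by rewrite lexx.
Qed.
End Spectral.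

(** * Words in independent group elements *)

(** The permutation matrix of the right translation by g, seen as the kernel of
    the walk whose step is the constant g. *)
Definition shift_mx (R : realType) (gT : finGroupType) (g : gT) : 'M[R]_#|gT| :=
  transition_mx (fun x => (x == g)%:R).

Definition pmf_prod (R : realType) (T I : finType) (mu : T -> R)
  (h : {ffun I -> T}) : R := \prod_i mu (h i).

Definition set_coord (I : finType) (T : Type) (h : {ffun I -> T}) (i : I) (y : T) :
  {ffun I -> T} := [ffun j => if j == i then y else h j].

(** Under a product law, replacing one coordinate by a fresh independent copy
    does not change any mean. The exchange of the old and the new value of the
    coordinate is an involution preserving the weights. *)
Lemma resample (R : realType) (T I : finType) (mu : T -> R) (V : lmodType R)
    (F : {ffun I -> T} -> V) (i : I) : \sum_x mu x = 1 ->
  \sum_h pmf_prod mu h *: F h =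
  \sum_h pmf_prod mu h *: \sum_y mu y *: F (set_coord h i y).
Proof.
move=> mu1; pose swap (p : {ffun I -> T} * T) := (set_coord p.1 i p.2, p.1 i).
have swapK : involutive swap.
  case=> h y; congr pair => /=; last by rewrite ffunE eqxx.
  by apply/ffunP => j; rewrite !ffunE; case: eqP => // ->.
have wE h y : pmf_prod mu (set_coord h i y) * mu (h i) = pmf_prod mu h * mu y.
  rewrite /pmf_prod (bigD1 i)// [in RHS](bigD1 i)//= ffunE eqxx.
  rewrite (eq_bigr (fun j => mu (h j))); last first.
    by move=> j /negbTE ji; rewrite ffunE ji.
  by rewrite mulrAC [RHS]mulrC mulrA (mulrC (mu y)).
transitivity (\sum_h \sum_y (pmf_prod mu h * mu y) *: F h).
  by apply: eq_bigr => h _; rewrite -scaler_suml -mulr_sumr mu1 mulr1.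
transitivity (\sum_h \sum_y (pmf_prod mu h * mu y) *: F (set_coord h i y)); last first.
  apply: eq_bigr => h _; rewrite scaler_sumr; apply: eq_bigr => y _.
  by rewrite scalerA.
rewrite !pair_big /= (reindex swap)/=; last exact: onW_bij (inv_bij swapK).
by apply: eq_bigr => -[h y] _ /=; rewrite wE.
Qed.

Section Words.
Variables (R : realType) (gT : finGroupType) (mu : gT -> R).
Hypothesis mu_pmf : is_pmf mu.
Local Notation P := (transition_mx mu).
Local Notation n := #|gT|.
Local Notation Sh := (@shift_mx R gT).

Lemma sum_enum_val (F : gT -> R) : \sum_(i < n) F (enum_val i) = \sum_x F x.
Proof.
rewrite (reindex (@enum_val _ gT))//=; last exact: onW_bij (@enum_val_bij gT).
Qed.

Lemma transition_ge0 i j : 0 <= P i j.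
Proof. by rewrite mxE; case: mu_pmf. Qed.

Lemma transition_row i : \sum_j P i j = 1.
Proof.
under eq_bigr do rewrite mxE.
rewrite (sum_enum_val (fun y => mu ((enum_val i)^-1 * y)%g)).
rewrite (reindex_inj (mulgI (enum_val i)))/=.
by under eq_bigr do rewrite mulKg; case: mu_pmf.
Qed.

Lemma transition_col j : \sum_i P i j = 1.
Proof.
under eq_bigr do rewrite mxE.
rewrite (sum_enum_val (fun y => mu (y^-1 * enum_val j)%g)).
rewrite (reindex_inj invg_inj)/= (reindex_inj (mulIg (enum_val j)^-1%g))/=.
by under eq_bigr do rewrite invgK mulgKV; case: mu_pmf.
Qed.

Lemma transition_sym : symmetric_pmf mu -> P^T = P.
Proof.
by move=> mu_sym; apply/matrixP => i j; rewrite !mxE mu_sym invMg invgK.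
Qed.

(** A random step is the average of the constant steps; this is the only link
    between P and the translations that the averaging below uses. *)
Lemma transition_shift : P = \sum_g mu g *: Sh g.
Proof.
apply/matrixP => i j; rewrite summxE.
set z := ((enum_val i)^-1 * enum_val j)%g.
rewrite (bigD1 z)//= !mxE eqxx mulr1 big1 ?addr0// => g gz.
by rewrite !mxE eq_sym (negbTE gz) mulr0.
Qed.

Lemma row_shift (v : 'rV[R]_n) a k :
  (v *m Sh a) 0 k = v 0 (enum_rank (enum_val k * a^-1)%g).
Proof.
rewrite mxE (bigD1 (enum_rank (enum_val k * a^-1)%g))//= mxE enum_rankK.
rewrite invMg invgK mulgKV eqxx mulr1 big1 ?addr0// => i ik; rewrite mxE.
case: eqP => [E|]; last by rewrite mulr0.
case/eqP: ik; apply: enum_val_inj; rewrite enum_rankK -E.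
by rewrite invMg invgK mulKVg.
Qed.

Lemma shiftM a b : Sh a *m Sh b = Sh (a * b)%g.
Proof.
apply/row_matrixP => i; rewrite row_mul; apply/rowP => k.
rewrite row_shift !mxE enum_rankK; congr (_%:R).
by rewrite mulgA -(inj_eq (mulIg b)) mulgKV.
Qed.

Lemma shift1 : Sh 1%g = 1%:M.
Proof.
apply/matrixP => i j; rewrite !mxE; congr (_%:R).
by rewrite -eq_invg_mul invgK (inj_eq enum_val_inj).
Qed.

Lemma prod_shift (I : Type) (r : seq I) (h : I -> gT) :
  \prod_(k <- r) Sh (h k) = Sh (\prod_(k <- r) h k)%g.
Proof.
elim: r => [|k r IH]; first by rewrite !big_nil shift1.
by rewrite !big_cons IH -shiftM.
Qed.

Lemma reindex_shift (F : 'I_n -> R) a :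
  \sum_(j < n) F (enum_rank (@enum_val _ gT j * a^-1)%g) = \sum_j F j.
Proof.
rewrite (sum_enum_val (fun y => F (enum_rank (y * a^-1)%g))).
rewrite (reindex_inj (mulIg a))/=; under eq_bigr do rewrite mulgK.
by rewrite -(sum_enum_val (F \o enum_rank))/=; under eq_bigr do rewrite /= enum_valK.
Qed.

Lemma sqnorm_shift (v : 'rV[R]_n) a : sqnorm (v *m Sh a) = sqnorm v.
Proof.
rewrite -[RHS](reindex_shift (fun j => v 0 j ^+ 2) a).
by apply: eq_bigr => j _; rewrite row_shift.
Qed.

Lemma sum_row_shift (v : 'rV[R]_n) a : \sum_j (v *m Sh a) 0 j = \sum_j v 0 j.
Proof.
rewrite -[RHS](reindex_shift (v 0) a).
by apply: eq_bigr => j _; rewrite row_shift.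
Qed.

Lemma sum_row_transition (v : 'rV[R]_n) : \sum_j (v *m P) 0 j = \sum_j v 0 j.
Proof.
under eq_bigr do rewrite mxE.
rewrite exchange_big/=; apply: eq_bigr => i _.
by rewrite -mulr_sumr transition_row mulr1.
Qed.

(** The word r in which the letters selected by a have been averaged, while the
    others are frozen to their values under h. *)
Definition mixed_word (I : eqType) (a : pred I) (h : I -> gT) (r : seq I) :
  'M[R]_n := \prod_(k <- r) (if a k then P else Sh (h k)).

Lemma mixed_word_cat (I : eqType) (a : pred I) (h : I -> gT) r1 i r2 :
  mixed_word a h (r1 ++ i :: r2) =
  mixed_word a h r1 * ((if a i then P else Sh (h i)) * mixed_word a h r2).
Proof. by rewrite /mixed_word big_cat big_cons. Qed.

(** The letter i occurs once, so the word is affine in the matrix put at that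
    place, and averaging over the value y of this letter puts P there. *)
Lemma mixed_word_step (I : finType) (S : seq I) (h : {ffun I -> gT}) (r : seq I) i :
  i \notin S -> count_mem i r = 1%N ->
  \sum_y mu y *: mixed_word (mem S) (set_coord h i y) r =
  mixed_word (mem (i :: S)) h r.
Proof.
move=> iS ci; have ir : i \in r by rewrite -has_pred1 has_count ci.
case/splitPr: ir ci => r1 r2; rewrite count_cat /= eqxx.
rewrite addnCA add1n => -[/eqP]; rewrite addn_eq0 => /andP[/eqP c1 /eqP c2].
have out s y : count_mem i s = 0%N ->
    mixed_word (mem S) (set_coord h i y) s = mixed_word (mem (i :: S)) h s.
  move=> /count_memPn i_s; apply: eq_big_seq => k ks /=.
  have ki : k != i by apply: contraNneq i_s => <-.
  by rewrite in_cons (negbTE ki) ffunE (negbTE ki).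
rewrite mixed_word_cat /= in_cons eqxx transition_shift mulr_suml mulr_sumr.
apply: eq_bigr => y _; rewrite mixed_word_cat /= (negbTE iS) ffunE eqxx.
rewrite !out//; apply: etrans (scalemxAr _ _ _) _.
by congr (_ *m _); exact: scalemxAl.
Qed.

(** The letters of S are averaged one after the other, each of them being first
    resampled independently of the frozen letters. *)
Lemma average_singletons (I : finType) (S r : seq I) :
  {in S, forall i, count_mem i r = 1%N} ->
  \sum_(h : {ffun I -> gT}) pmf_prod mu h *: Sh (\prod_(k <- r) h k)%g =
  \sum_h pmf_prod mu h *: mixed_word (mem S) h r.
Proof.
elim: S => [_|i S IH iS].
  by apply: eq_bigr => h _; rewrite -prod_shift.
rewrite IH; last by move=> j jS; apply: iS; rewrite in_cons jS orbT.
have [iinS|iinS] := boolP (i \in S).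
  apply: eq_bigr => h _; congr (_ *: _); apply: eq_bigr => k _ /=.
  by rewrite in_cons; case: eqP => // ->; rewrite iinS.
rewrite (resample _ i) ?(proj2 mu_pmf)//; apply: eq_bigr => h _.
by rewrite mixed_word_step// iS// mem_head.
Qed.

Variable lam : R.
Hypothesis lam_ge0 : 0 <= lam.
Hypothesis P_contract : forall v : 'rV[R]_n, \sum_j v 0 j = 0 ->
  sqnorm (v *m P) <= lam ^+ 2 * sqnorm v.

Lemma mixed_word_contract (I : eqType) (a : pred I) (h : I -> gT) (r : seq I)
    (v : 'rV[R]_n) : \sum_j v 0 j = 0 ->
  sqnorm (v *m mixed_word a h r) <= (lam ^+ count a r) ^+ 2 * sqnorm v.
Proof.
elim: r v => [|k r IH] v v0.
  by rewrite /mixed_word big_nil mulmx1 expr1n mul1r.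
rewrite /mixed_word big_cons mulmxA -/(mixed_word _ _ _) /=.
case: (a k); last by rewrite (le_trans (IH _ _)) ?sum_row_shift// sqnorm_shift.
rewrite (le_trans (IH _ _)) ?sum_row_transition// exprD expr1 exprMn mulrC.
by rewrite [leRHS]mulrAC ler_wpM2r ?sqr_ge0// P_contract.
Qed.

(** The positions of r whose entry occurs nowhere else; they are as many as the
    values occurring exactly once. *)
Definition singletons (I : eqType) (r : seq I) : nat :=
  count (fun k => count_mem k r == 1%N) r.

Definition word_law (I : finType) (r : seq I) (g : gT) : R :=
  \sum_(h : {ffun I -> gT}) pmf_prod mu h * ((\prod_(k <- r) h k)%g == g)%:R.

Lemma pmf_prod_ge0 (I : finType) (h : {ffun I -> gT}) : 0 <= pmf_prod mu h.
Proof. by apply: prodr_ge0 => i _; case: mu_pmf. Qed.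

Lemma sum_pmf_prod (I : finType) : \sum_(h : {ffun I -> gT}) pmf_prod mu h = 1.
Proof.
rewrite /pmf_prod -(bigA_distr_bigA (fun _ => mu))/=.
by rewrite big1// => i _; case: mu_pmf.
Qed.

(** The difference with the uniform law is the image, under the averaged words,
    of the vector v below, of sum zero and Euclidean norm at most 1: the uniform
    law is invariant under every translation.  An entry of a vector is at most
    its norm, and there are #|gT| entries. *)
Lemma word_law_near_uniform (I : finType) (r : seq I) :
  tv_dist (word_law r) (@uniform_pmf R gT) <= n%:R / 2 * lam ^+ singletons r.
Proof.
have n0 : n%:R != 0 :> R.
  by rewrite pnatr_eq0 -lt0n; apply/card_gt0P; exists 1%g.
pose v : 'rV[R]_n := \row_j ((enum_val j == 1%g)%:R - n%:R^-1).
have v_sum : \sum_j v 0 j = 0.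
  under eq_bigr do rewrite mxE.
  rewrite (sum_enum_val (fun y => (y == 1%g)%:R - n%:R^-1)) sumrB.
  rewrite (bigD1 1%g)//= eqxx big1 ?addr0; last by move=> i /negbTE->.
  by rewrite sumr_const -[_^-1 *+ _]mulr_natl mulfV// subrr.
have v_norm : sqnorm v <= 1.
  rewrite /sqnorm; under eq_bigr do rewrite mxE.
  rewrite (sum_enum_val (fun y => ((y == 1%g)%:R - n%:R^-1) ^+ 2)).
  under eq_bigr do rewrite sqrrB.
  rewrite big_split sumrB /= (bigD1 1%g)//= eqxx big1 ?addr0; last first.
    by move=> i /negbTE->; rewrite expr0n.
  rewrite [X in _ - X + _](bigD1 1%g)//= eqxx big1 ?addr0; last first.
    by move=> i /negbTE->; rewrite mul0r mul0rn.
  rewrite sumr_const -[_ ^+ 2 *+ _]mulr_natl /= ?mulr1n.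
  have -> : n%:R * n%:R^-1 ^+ 2 = n%:R^-1 :> R by rewrite expr2 mulrA mulfV// mul1r.
  have : 0 <= n%:R^-1 :> R by rewrite invr_ge0.
  by lra.
pose S := [seq k <- r | count_mem k r == 1%N].
have S1 : {in S, forall i, count_mem i r = 1%N}.
  by move=> i; rewrite mem_filter => /andP[/eqP].
have diffE g : word_law r g - @uniform_pmf R gT g =
    \sum_h pmf_prod mu h * (v *m mixed_word (mem S) h r) 0 (enum_rank g).
  transitivity ((v *m \sum_(h : {ffun I -> gT})
      pmf_prod mu h *: Sh (\prod_(k <- r) h k)%g) 0 (enum_rank g)).
    rewrite /word_law /uniform_pmf -[n%:R^-1]mul1r -[X in _ - X * _](sum_pmf_prod I).
    rewrite mulr_suml -sumrB mulmx_sumr summxE; apply: eq_bigr => h _.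
    rewrite -scalemxAr [RHS]mxE row_shift !enum_rankK mxE enum_rankK -mulrBr.
    by rewrite -eq_mulgV1 (eq_sym g).
  rewrite (average_singletons S1) mulmx_sumr summxE; apply: eq_bigr => h _.
  by rewrite -scalemxAr mxE.
have bound h k : `|(v *m mixed_word (mem S) h r) 0 k| <= lam ^+ singletons r.
  have cS : count (mem S) r = singletons r.
    apply: eq_in_count => k' k'r /=; rewrite mem_filter k'r andbT.
    by [].
  rewrite -(@ler_pXn2r _ 2)// ?nnegrE ?exprn_ge0// real_normK ?num_real//.
  apply: (@le_trans _ _ (sqnorm (v *m mixed_word (mem S) h r))).
    by rewrite /sqnorm (bigD1 k)//= lerDl sumr_ge0// => j _; rewrite sqr_ge0.
  rewrite (le_trans (mixed_word_contract _ _ _ v_sum))// cS.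
  by rewrite ler_piMr// sqr_ge0.
rewrite /tv_dist mulrC mulrAC ler_pM2r ?invr_gt0//.
apply: (@le_trans _ _ (\sum_(g : gT) lam ^+ singletons r)); last first.
  by rewrite sumr_const mulr_natl.
apply: ler_sum => g _; rewrite diffE (le_trans (ler_norm_sum _ _ _))//.
rewrite -[leRHS]mul1r -(sum_pmf_prod I) mulr_suml ler_sum// => h _.
by rewrite normrM ger0_norm ?pmf_prod_ge0// ler_wpM2l ?pmf_prod_ge0.
Qed.
End Words.

(** * Singletons in a random genealogy *)

Lemma singletons_fresh (I : eqType) (r : seq I) x : x \notin r ->
  singletons (rcons r x) = (singletons r).+1.
Proof.
move=> xr; rewrite /singletons -cats1 count_cat /= addn0.
rewrite count_cat /= eqxx (count_memPn xr) /= addn1; congr _.+1.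
apply: eq_in_count => k kr; rewrite count_cat /=.
have /negbTE-> : x != k by apply: contraNneq xr => ->.
by rewrite !addn0.
Qed.

(** Repeating x destroys the singleton x if there is one, and the new entry is
    never a singleton. *)
Lemma singletons_repeat (I : eqType) (r : seq I) x : x \in r ->
  (singletons (rcons r x) + (count_mem x r == 1%N))%N = singletons r.
Proof.
move=> xr; have cx : (0 < count_mem x r)%N by rewrite -has_count has_pred1.
rewrite /singletons -cats1 count_cat /= addn0 count_cat /= eqxx addn1.
rewrite eqSS eqn0Ngt cx addn0.
have -> : count (fun k => count_mem k r == 1%N) r =
    (count (fun k => (count_mem k r == 1%N) && (k != x)) r +
     count (fun k => (count_mem k r == 1%N) && (k == x)) r)%N.
  rewrite -[LHS]size_filter -(count_predC (predC1 x)) !count_filter.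
  by congr (_ + _)%N; apply: eq_count => k /=; rewrite ?negbK andbC.
congr (_ + _)%N.
  apply: eq_in_count => k kr; rewrite count_cat /= addn0 (eq_sym x).
  have ck : (0 < count_mem k r)%N by rewrite -has_count has_pred1.
  have [->|_] := eqVneq k x; last by rewrite addn0 andbT.
  by rewrite addn1 andbF eqSS eqn0Ngt cx.
have [c1|c1] := eqVneq (count_mem x r) 1%N.
  transitivity (count_mem x r); first by rewrite c1.
  apply: eq_count => k /=; have [->|] := eqVneq k x; last by rewrite andbF.
  by rewrite c1.
rewrite -[LHS](count_pred0 r); apply: eq_count => k /=.
by have [->|] := eqVneq k x; rewrite ?andbF// (negbTE c1).
Qed.

Section OneStep.
Variables (R : realType) (alpha theta : R).
Local Notation a := ((1 - alpha) * (1 - theta)).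

(** The mean of F after one reinforced step from the labels r. *)
Definition reinforce_mean (I : finType) (F : seq I -> R) (fresh : I) (r : seq I) :=
  (1 - alpha) * F (rcons r fresh) +
  alpha / (size r)%:R * \sum_(x <- r) F (rcons r x).

(** With y = K * (1 - theta), one has theta ^ K <= e^(-y), and the claim is
    theta ^ K * (1 + (y - t)) <= e^(-t), which follows from
    1 + x <= e^x.  It is the tangent at e^(-t) of the concave function
    z * log (1 / z), stated without logarithms; t is left free to be adapted to
    the time. *)
Lemma power_tangent (K : nat) (t : R) : 0 <= theta ->
  theta ^+ K * (K%:R * (1 - theta)) <= theta ^+ K * (t - 1) + expR (- t).
Proof.
move=> th0; set y := K%:R * (1 - theta).
have thK : theta ^+ K <= expR (- y).
  rewrite /y -mulrN expRM_natl lerXn2r ?nnegrE ?expR_ge0//.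
  by rewrite (le_trans _ (expR_ge1Dx _))//; lra.
have : theta ^+ K * (1 + (y - t)) <= expR (- t).
  rewrite (le_trans (ler_wpM2l (exprn_ge0 K th0) (expR_ge1Dx (y - t))))//.
  rewrite (le_trans (ler_wpM2r (expR_ge0 _) thK))// -expRD.
  by rewrite (_ : - y + (y - t) = - t)//; ring.
by move: (theta ^+ K) {thK} y => p y; lra.
Qed.

(** The singletons destroyed contribute the factor
    alpha * (K / n) * (1 - theta) / theta, and alpha / theta <= 2. *)
Lemma reinforce_singletons (I : finType) (fresh : I) (r : seq I) t :
    0 <= alpha -> alpha <= 1 -> 2^-1 <= theta -> theta <= 1 ->
    (0 < size r)%N -> fresh \notin r ->
  reinforce_mean (fun s => theta ^+ singletons s) fresh r <=
  theta ^+ singletons r * (1 - a + 2 / (size r)%:R * (t - 1)) +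
    2 / (size r)%:R * expR (- t).
Proof.
move=> al0 al1 th_ge th_le r0 fr; rewrite /reinforce_mean singletons_fresh//.
have th0 : 0 < theta by lra.
have om0 : 0 <= 1 - theta by lra.
have alpha_th : alpha / theta <= 2 by rewrite ler_pdivrMr//; lra.
set n : R := (size r)%:R; set K := singletons r; set p := theta ^+ K.
have n0 : 0 < n by rewrite ltr0n.
have p0 : 0 <= p by rewrite exprn_ge0// ltW.
have -> : \sum_(x <- r) theta ^+ singletons (rcons r x) =
    p * (n + K%:R * (theta^-1 - 1)).
  transitivity (\sum_(x <- r) (p + p * (theta^-1 - 1) * (count_mem x r == 1%N)%:R)).
    apply: eq_big_seq => x /singletons_repeat; rewrite /p /K => <-.
    case: eqP => _; rewrite ?addn0 ?addn1 ?mulr0 ?addr0//.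
    by rewrite exprS mulr1; field; rewrite gt_eqF.
  rewrite big_split /= -mulr_sumr big_const_seq count_predT iter_addr_0.
  rewrite -natr_sum -(big_mkcond (fun x => count_mem x r == 1%N) (fun=> 1%N)).
  by rewrite sum1_count -/K -mulr_natr /n; ring.
have tangent := power_tangent K t (ltW th0); rewrite -/p in tangent.
have q0 : 0 <= p * (K%:R * (1 - theta)) by rewrite !mulr_ge0.
rewrite exprS -/p.
have -> : (1 - alpha) * (theta * p) + alpha / n * (p * (n + K%:R * (theta^-1 - 1)))
    = p * (1 - a) + n^-1 * (alpha / theta * (p * (K%:R * (1 - theta)))).
  by field; rewrite !gt_eqF.
have -> : p * (1 - a + 2 / n * (t - 1)) + 2 / n * expR (- t) =
   p * (1 - a) + n^-1 * (2 * (p * (t - 1) + expR (- t))).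
  by ring.
rewrite lerD2l ler_wpM2l ?invr_ge0 ?(ltW n0)//.
by rewrite (le_trans (ler_wpM2r q0 alpha_th))// ler_wpM2l.
Qed.
End OneStep.

(** The possible values of the pair (xi_(k+2), u_(k+2)). *)
Definition steps (k : nat) : seq (bool * nat) :=
  [seq (b, j) | b <- [:: true; false], j <- iota 1 k.+1].

Fixpoint genealogies (m : nat) : seq (seq (bool * nat)) :=
  if m is m'.+1 then [seq rcons c t | c <- genealogies m', t <- steps m']
  else [:: [::]].

Definition step_weight (R : realType) (alpha : R) (k : nat) (t : bool * nat) : R :=
  (if t.1 then alpha else 1 - alpha) / k.+1%:R.

Definition genealogy_weight (R : realType) (alpha : R) (c : seq (bool * nat)) : R :=
  \prod_(k < size c) step_weight alpha k (nth (true, 0%N) c k).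

(** A label is the rank, counted from 0, of the step at which a sample was first
    used.  The list of labels before step n = size r + 1 has entries for the
    steps 1, ..., n - 1, whence the shift by one in the choice u; a fresh step
    gets its own rank as label.  Labels live in 'I_M.+1, so this is meaningful
    as long as size r <= M. *)
Definition add_label M (r : seq 'I_M.+1) (t : bool * nat) : seq 'I_M.+1 :=
  rcons r (if t.1 then nth ord0 r t.2.-1 else inord (size r)).

(** Step 1 is always fresh. *)
Definition labels M (c : seq (bool * nat)) : seq 'I_M.+1 :=
  foldl (@add_label M) [:: ord0] c.

Lemma mem_genealogies m c : c \in genealogies m.+1 ->
  exists c' t, [/\ c' \in genealogies m, t \in steps m & c = rcons c' t].
Proof. by move=> /allpairsPdep. Qed.

Lemma labels_rcons M c t : labels M (rcons c t) = add_label (labels M c) t.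
Proof. by rewrite /labels foldl_rcons. Qed.

Lemma size_labels M c : size (labels M c) = (size c).+1.
Proof.
by elim/last_ind: c => // c t IH; rewrite labels_rcons !size_rcons IH.
Qed.

Lemma size_genealogy m c : c \in genealogies m -> size c = m.
Proof.
elim: m c => [|m IH] c; first by rewrite inE => /eqP->.
by case/mem_genealogies => c' [t] [/= /IH + _ ->]; rewrite size_rcons => ->.
Qed.

(** Labels refer to past steps, which is what makes a fresh label new. *)
Lemma labels_lt M m c x : (m <= M)%N -> c \in genealogies m ->
  x \in labels M c -> (x < m.+1)%N.
Proof.
elim: m c x => [|m IH] c x mM.
  by rewrite /= !inE => /eqP-> /=; rewrite inE => /eqP->.
case/mem_genealogies => c' [t] [/= c'm tm ->]; have sc := size_genealogy c'm.
rewrite labels_rcons mem_rcons inE => /orP[/eqP->|]; last first.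
  by move=> /(IH _ _ (ltnW mM) c'm) /ltnW.
have sl : size (labels M c') = m.+1 by rewrite size_labels sc.
case: t.1; last by rewrite inordK sl.
have [lt|ge] := ltnP t.2.-1 (size (labels M c')).
  by rewrite ltnW// ltnS (IH c')// ?mem_nth// ltnW.
by rewrite nth_default.
Qed.

Section GenealogyMean.
Variables (R : realType) (alpha theta : R) (M : nat).
Local Notation a := ((1 - alpha) * (1 - theta)).

Definition genealogy_mean (m : nat) (F : seq 'I_M.+1 -> R) : R :=
  \sum_(c <- genealogies m) genealogy_weight alpha c * F (labels M c).

Lemma genealogy_weight_rcons c t :
  genealogy_weight alpha (rcons c t) =
  genealogy_weight alpha c * step_weight alpha (size c) t.
Proof.
rewrite /genealogy_weight size_rcons big_ord_recr /= nth_rcons ltnn eqxx.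
by congr (_ * _); apply: eq_bigr => i _; rewrite nth_rcons ltn_ord.
Qed.

Lemma genealogy_weight_ge0 c : 0 <= alpha -> alpha <= 1 -> 0 <= genealogy_weight alpha c.
Proof.
move=> al0 al1; apply: prodr_ge0 => k _; rewrite /step_weight divr_ge0//.
by case: ifP => _; lra.
Qed.

Lemma sum_steps m (F : bool * nat -> R) :
  \sum_(t <- steps m) step_weight alpha m t * F t =
  alpha / m.+1%:R * \sum_(j <- iota 1 m.+1) F (true, j) +
  (1 - alpha) / m.+1%:R * \sum_(j <- iota 1 m.+1) F (false, j).
Proof.
by rewrite /steps big_allpairs big_cons big_seq1 !mulr_sumr.
Qed.

Lemma genealogy_mean_succ m F :
  genealogy_mean m.+1 F = \sum_(c <- genealogies m) genealogy_weight alpha c *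
    reinforce_mean alpha F (inord m.+1) (labels M c).
Proof.
rewrite /genealogy_mean.
rewrite -[genealogies m.+1]/[seq rcons c t | c <- genealogies m, t <- steps m].
rewrite big_allpairs_dep; apply: eq_big_seq => c cm.
have sc := size_genealogy cm; have sl := size_labels M c.
under eq_bigr do rewrite genealogy_weight_rcons -mulrA labels_rcons.
rewrite -mulr_sumr sc sum_steps /reinforce_mean addrC sl sc; congr (_ * (_ + _)).
  rewrite (eq_bigr (fun=> F (rcons (labels M c) (inord m.+1)))); last first.
    by move=> j _; rewrite /add_label sl sc.
  rewrite big_const_seq count_predT iter_addr_0 size_iota.
  by rewrite -mulr_natr; field.
congr (_ * _); rewrite (iotaDl 1 0) big_map [in RHS](big_nth ord0) sl sc.
by rewrite /index_iota subn0; apply: eq_bigr.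
Qed.

Lemma genealogy_mean1 m : genealogy_mean m (fun=> 1) = 1.
Proof.
elim: m => [|m IH].
  by rewrite /genealogy_mean big_seq1 /genealogy_weight big_ord0 mulr1.
rewrite genealogy_mean_succ -[RHS]IH; apply: eq_bigr => c _.
rewrite /reinforce_mean big_const_seq count_predT iter_addr_0 size_labels.
by congr (_ * _); field.
Qed.

(** By induction, with t = a * n / 4 - 1 at n = m + 1.  The recursion is
    f_(n+1) <= f_n * (1 - a / 2 - 4 / n) + (2 / n) * e^(-t), and the last term
    is more than compensated by the term - 4 / n, leaving the factor
    1 - a / 2 <= e^(- a / 4).  The induction hypothesis can be used only where
    the coefficient of f_n is nonnegative, which holds for n >= 6 as
    a <= 1/2; for n <= 6 the bound is at least 1 and hence trivial.  This is the
    role of the constant 1 in the exponent. *)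
Lemma genealogy_mean_singletons m :
  0 <= alpha -> alpha <= 1 -> 2^-1 <= theta -> theta <= 1 ->
  (m <= M)%N ->
  genealogy_mean m (fun r => theta ^+ singletons r) <=
  expR (- (a * m.+1%:R / 4 - 1)).
Proof.
move=> al0 al1 th_ge th_le.
have a_ge0 : 0 <= a by rewrite mulr_ge0//; lra.
have a_le : a <= 2^-1 by nra.
elim: m => [|m IH] mM; last have [m5|m5] := ltnP m 5; last first.
- have {IH} := IH (ltnW mM).
  set f := genealogy_mean m _; set n : R := m.+1%:R; set t := a * n / 4 - 1.
  move=> IH; have n6 : 6 <= n by rewrite ler_nat.
  have step : genealogy_mean m.+1 (fun r => theta ^+ singletons r) <=
      f * (1 - a + 2 / n * (t - 1)) + 2 / n * expR (- t).
    rewrite genealogy_mean_succ -[X in _ + X]mul1r -[X in _ + X * _](genealogy_mean1 m).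
    rewrite /f /genealogy_mean !mulr_suml -big_split /= [leLHS]big_seq [leRHS]big_seq.
    apply: ler_sum => c cm; rewrite mulr1 -mulrA -mulrDr ler_wpM2l ?genealogy_weight_ge0//.
    have sl : size (labels M c) = m.+1 by rewrite size_labels (size_genealogy cm).
    rewrite /n -sl; apply: reinforce_singletons => //; first by rewrite sl.
    apply/negP => /(labels_lt (ltnW mM) cm); rewrite sl inordK//.
    by rewrite ltnn.
  have n0 : 0 < n by lra.
  have i6 : n^-1 <= 6^-1 by rewrite lef_pV2 ?posrE.
  have coef : 1 - a + 2 / n * (t - 1) = 1 - a / 2 - 4 / n.
    by rewrite /t; field; rewrite gt_eqF.
  rewrite (le_trans step)// coef.
  have c0 : 0 <= 1 - a / 2 - 4 / n by move: a_le i6; move: a n^-1 => A ni; lra.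
  rewrite (le_trans (lerD (ler_wpM2r c0 IH) (lexx _)))//.
  have -> : - (a * m.+2%:R / 4 - 1) = - t + - (a / 4).
    by rewrite /t /n -[m.+2]addn1 natrD; field.
  rewrite expRD; have := expR_ge1Dx (- (a / 4)); have := expR_gt0 (- t).
  have : 0 < n^-1 by rewrite invr_gt0.
  set e := expR (- t); set e' := expR (- (a / 4)); move=> ni e0 e'1.
  have -> : e * (1 - a / 2 - 4 / n) + 2 / n * e = e * (1 - a / 2 - 2 / n).
    by ring.
  rewrite ler_pM2l//; move: ni e'1 a_ge0; move: a n^-1 e' => A ni e'; lra.
all: apply: (@le_trans _ _ 1).
- rewrite -(genealogy_mean1 m.+1); apply: ler_sum => c _.
  by rewrite ler_wpM2l ?genealogy_weight_ge0// exprn_ile1//; lra.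
- have am : a * m.+2%:R <= 2^-1 * 6 by rewrite ler_pM// ler_nat.
  by rewrite -[leLHS]expR0 ler_expR; move: (a * m.+2%:R) am => x; lra.
- rewrite -(genealogy_mean1 0); apply: ler_sum => c _.
  by rewrite ler_wpM2l ?genealogy_weight_ge0// exprn_ile1//; lra.
- by rewrite -[leLHS]expR0 ler_expR; move: a_le; move: a => A; lra.
Qed.
End GenealogyMean.

(** * The law of the walk *)

Lemma uniq_genealogies m : uniq (genealogies m).
Proof.
elim: m => // m IH; apply: allpairs_uniq => //.
  by apply: allpairs_uniq; rewrite ?iota_uniq// => -[? ?] [? ?].
by move=> [c t] [c' t'] _ _ /= /rcons_inj.
Qed.

Lemma nth_genealogy m c k : c \in genealogies m -> (k < m)%N ->
  (1 <= (nth (true, 0%N) c k).2 < k.+2)%N.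
Proof.
elim: m c => // m IH c /mem_genealogies [c' [t [c'm tm ->]]].
rewrite nth_rcons (size_genealogy c'm) ltnS leq_eqVlt => /orP[/eqP->|km].
  rewrite ltnn eqxx; case/allpairsPdep: tm => b [j [_ + ->]].
  by rewrite mem_iota add1n.
by rewrite km IH.
Qed.

(** Finite additivity over the values of a discrete variable.  Measurability is
    part of the conclusion because additivity at the next value requires it. *)
Lemma measure_finite_range d (Omega : measurableType d) (R : realType)
    (Pr : probability Omega R) (T : eqType) (V : Omega -> T) (A : pred T) (s : seq T) :
    uniq s -> (forall t, t \in s -> measurable [set w | V w = t]) ->
  measurable [set w | A (V w) && (V w \in s)] /\
  Pr [set w | A (V w) && (V w \in s)] =
    (\sum_(t <- s | A t) Pr [set w | V w = t])%E.
Proof.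
elim: s => [_ _|t s IH /= /andP[ts us] mV].
  rewrite big_nil (_ : [set w | _] = set0) ?measure0//.
  by apply/seteqP; split => w //=; rewrite andbF.
have [ms Prs] := IH us (fun x xs => mV x (@mem_behead _ (t :: s) x xs)).
have mt := mV t (mem_head _ _); rewrite big_cons.
have [At|At] := boolP (A t).
  rewrite (_ : [set w | _] = [set w | V w = t] `|` [set w | A (V w) && (V w \in s)]).
    split; first exact: measurableU.
    rewrite -Prs; apply: measureU => //; apply/seteqP; split => w //= [-> /andP[_]].
    by rewrite (negbTE ts).
  apply/seteqP; split => w /=; rewrite in_cons.
    by case/andP => -> /orP[/eqP->|->]; [left|right].
  by case=> [->|/andP[-> ->]]; rewrite ?At ?eqxx ?orbT.
rewrite (_ : [set w | _] = [set w | A (V w) && (V w \in s)])//.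
apply/seteqP; split => w /=; rewrite in_cons.
  by case/andP => AV /orP[/eqP Vt|->]; [move: AV; rewrite Vt (negbTE At)|rewrite AV].
by case/andP => -> ->; rewrite orbT.
Qed.

Section LawOfWalk.
Context d (Omega : measurableType d) (R : realType) (Pr : probability Omega R).
Variables (gT : finGroupType) (mu : gT -> R) (alpha : R).
Variables (xi : nat -> Omega -> bool) (u : nat -> Omega -> nat).
Variables (eta X : nat -> Omega -> gT) (S : nat -> Omega -> gT).
Hypothesis rand : srrw_randomness Pr mu alpha xi u eta.
Hypothesis X1 : forall w, X 1%N w = eta 1%N w.
Hypothesis XS : forall n w, (2 <= n)%N ->
  X n w = if xi n w then X (u n w) w else eta n w.
Hypothesis S0 : forall w, S 0%N w = 1%g.
Hypothesis SS : forall n w, S n.+1 w = (S n w * X n.+1 w)%g.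
Variable M : nat.

(** Step 1 involves no choice, so the history starts at step 2; samples are
    likewise counted from 1. *)
Definition history m w := [seq (xi k.+2 w, u k.+2 w) | k <- iota 0 m].

Definition samples w : {ffun 'I_M.+1 -> gT} := [ffun i : 'I_M.+1 => eta i.+1 w].

Lemma history_succ m w : history m.+1 w = rcons (history m w) (xi m.+2 w, u m.+2 w).
Proof. by rewrite /history -[X in iota 0 X]addn1 iotaD map_cat /= add0n cats1. Qed.

Lemma size_history m w : size (history m w) = m.
Proof. by rewrite size_map size_iota. Qed.

Lemma history_genealogies m w : history m w \in genealogies m.
Proof.
elim: m => // m IH; rewrite history_succ; apply: allpairs_f => //.
apply: allpairs_f; first by case: (xi _ w).
by rewrite mem_iota add1n; exact: srrw_u_range rand _ _ _.
Qed.

(** The first half, on the individual steps, is what lets a repeated step inherit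
    the label of the step that it copies. *)
Lemma walk_as_word m w : (m <= M)%N ->
  (forall k, (k <= m)%N ->
     X k.+1 w = eta (nth ord0 (labels M (history m w)) k).+1 w) /\
  S m.+1 w = (\prod_(i <- labels M (history m w)) samples w i)%g.
Proof.
elim: m => [_|m IH mM].
  split; first by case.
  by rewrite SS S0 mul1g X1 big_seq1 ffunE.
have [IHX IHS] := IH (ltnW mM); rewrite history_succ labels_rcons.
have sl : size (labels M (history m w)) = m.+1 by rewrite size_labels size_history.
have last_label : X m.+2 w = eta (last ord0
    (add_label (labels M (history m w)) (xi m.+2 w, u m.+2 w))).+1 w.
  rewrite XS// /add_label last_rcons /=; case: ifP => _; last first.
    by rewrite sl inordK.
  have /andP[u1 u2] := srrw_u_range rand (n := m.+2) w isT.
  by rewrite -IHX ?prednK// -ltnS prednK.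
split=> [k|]; last first.
  by rewrite SS last_label IHS /add_label last_rcons big_rcons /= ffunE.
rewrite leq_eqVlt => /orP[/eqP->|].
  by rewrite last_label (last_nth ord0) /add_label size_rcons sl /=.
rewrite ltnS => km; rewrite IHX// /add_label nth_rcons sl ltnS km.
by [].
Qed.

Lemma xi_law k b : Pr (xi k.+2 @^-1` [set b]) = (if b then alpha else 1 - alpha)%:E.
Proof.
have xiT : xi k.+2 @^-1` [set true] = [set w | xi k.+2 w].
  by apply/seteqP; split => w /=; case: (xi _ w).
have xi_a : Pr (xi k.+2 @^-1` [set true]) = alpha%:E.
  by rewrite xiT (srrw_xi_law rand).
case: b => //; rewrite (_ : _ @^-1` _ = ~` (xi k.+2 @^-1` [set true])).
  rewrite probability_setC ?xi_a//.
  exact: (srrw_independent rand).1 (inl (inl k)) [set true].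
by apply/seteqP; split => w /=; case: (xi _ w).
Qed.

(** A configuration is an intersection of one event for each variable xi, u, eta
    involved, so mutual independence turns its probability into a product. *)
Lemma configuration_law m c (h : {ffun 'I_M.+1 -> gT}) : c \in genealogies m ->
  measurable [set w | (history m w, samples w) = (c, h)] /\
  Pr [set w | (history m w, samples w) = (c, h)] =
    (genealogy_weight alpha c * pmf_prod mu h)%:E.
Proof.
move=> cm; have sc := size_genealogy cm.
pose t k := nth (true, 0%N) c k.
pose A (i : nat + nat + nat) : set (srrw_value gT i) :=
  match i return set (srrw_value gT i) with
  | inl (inl k) => [set (t k).1]
  | inl (inr k) => [set (t k).2]
  | inr k => [set h (inord k)]
  end.
pose s : seq (nat + nat + nat) := [seq inl (inl k) | k <- iota 0 m] ++
  [seq inl (inr k) | k <- iota 0 m] ++ [seq inr k | k <- iota 0 M.+1].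
have us : uniq s.
  rewrite !cat_uniq !map_inj_uniq ?iota_uniq ?andbT; try by move=> ? ? [].
  apply/and4P; split => //; apply/hasPn => i.
    by rewrite mem_cat => /orP[] /mapP[k _ ->]; apply/mapP => -[].
  by move=> /mapP[k _ ->]; apply/mapP => -[].
have eventE : [set w | (history m w, samples w) = (c, h)] =
    \bigcap_(i in [set` s]) (srrw_family xi u eta i @^-1` A i).
  apply/seteqP; split => w /=.
    move=> [pw sw] i /=; rewrite !mem_cat => /or3P[] /mapP[k + ->] /=;
      rewrite mem_iota add0n => /andP[_ km].
    - by rewrite /t -pw (nth_map 0%N) ?size_iota// nth_iota.
    - by rewrite /t -pw (nth_map 0%N) ?size_iota// nth_iota.
    - by rewrite -sw ffunE inordK.
  move=> Aw; congr pair.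
    apply: (@eq_from_nth _ (true, 0%N)); rewrite size_history ?sc// => k km.
    rewrite (nth_map 0%N) ?size_iota// nth_iota// add0n.
    have := Aw (inl (inl k)); have := Aw (inl (inr k)); rewrite /= !mem_cat.
    have ki : k \in iota 0 m by rewrite mem_iota.
    rewrite !map_f ?orbT// => /(_ isT) -> /(_ isT) ->.
    by rewrite /t; case: (nth _ _ _).
  apply/ffunP => i; rewrite ffunE; have := Aw (inr (i : nat)).
  rewrite /= !mem_cat map_f ?orbT ?mem_iota ?ltn_ord// => /(_ isT) ->.
  by rewrite inord_val.
have mA i : measurable (srrw_family xi u eta i @^-1` A i).
  exact: (srrw_independent rand).1.
split; first by rewrite eventE; apply: fin_bigcap_measurable.
rewrite eventE (srrw_independent rand).2// /s !big_cat !big_map /=.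
have -> : (\prod_(k <- iota 0 m) Pr (xi k.+2 @^-1` [set (t k).1]))%E =
    (\prod_(k <- iota 0 m) (if (t k).1 then alpha else 1 - alpha))%:E.
  by rewrite -prodEFin; apply: eq_bigr => k _; exact: xi_law.
have -> : (\prod_(k <- iota 0 m) Pr (u k.+2 @^-1` [set (t k).2]))%E =
    (\prod_(k <- iota 0 m) (k.+1%:R^-1))%:E.
  rewrite -prodEFin; apply: eq_big_seq => k; rewrite mem_iota add0n => /andP[_ km].
  by rewrite (srrw_u_law rand)// (nth_genealogy cm).
have -> : (\prod_(k <- iota 0 M.+1) Pr (eta k.+1 @^-1` [set h (inord k)]))%E =
    (\prod_(k <- iota 0 M.+1) mu (h (inord k)))%:E.
  by rewrite -prodEFin; apply: eq_bigr => k _; rewrite (srrw_eta_law rand).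
rewrite -!EFinM mulrA; congr (_ * _)%:E.
  rewrite -big_split /genealogy_weight sc /= -(big_mkord xpredT (fun k =>
    step_weight alpha k (t k))).
  by rewrite /index_iota subn0.
rewrite /pmf_prod -{1}(subn0 M.+1) -/(index_iota 0 M.+1) big_mkord.
by apply: eq_bigr => i _; rewrite inord_val.
Qed.

(** Given its genealogy, the walk is a word in independent samples. *)
Lemma srrw_law g : law Pr (S M.+1) g =
  \sum_(c <- genealogies M) genealogy_weight alpha c * word_law mu (labels M c) g.
Proof.
pose V w := (history M w, samples w).
pose range := [seq (c, h) | c <- genealogies M, h <- enum {ffun 'I_M.+1 -> gT}].
pose A (t : seq (bool * nat) * {ffun 'I_M.+1 -> gT}) :=
  (\prod_(i <- labels M t.1) t.2 i)%g == g.
have ur : uniq range.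
  by apply: allpairs_uniq; rewrite ?uniq_genealogies ?enum_uniq// => -[? ?] [? ?].
have mV t : t \in range -> measurable [set w | V w = t].
  by case/allpairsPdep => c [h [cM _ ->]]; exact: (configuration_law _ cM).1.
have [_] := measure_finite_range Pr A ur mV.
have -> : [set w | A (V w) && (V w \in range)] = [set w | S M.+1 w = g].
  apply/seteqP; split => w /=; rewrite (walk_as_word w (leqnn M)).2.
    by case/andP => /eqP.
  move=> Sg; rewrite /A /= Sg eqxx allpairs_f ?history_genealogies//.
  by rewrite mem_enum.
rewrite /law => ->; rewrite big_mkcond big_allpairs.
transitivity (fine (\sum_(c <- genealogies M)
    (genealogy_weight alpha c * word_law mu (labels M c) g)%:E)%E); last first.
  by rewrite sumEFin.
congr fine; apply: eq_big_seq => c cM.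
rewrite /word_law mulr_sumr -sumEFin big_enum/=; apply: eq_bigr => h _.
rewrite mulrA -[X in _ = (X * _)%:E]/(_ * _) /A /=.
case: eqP => _; last by rewrite mulr0.
by rewrite (configuration_law _ cM).2 mulr1.
Qed.
End LawOfWalk.

(** * Mixing *)

(** Total variation distance is convex. *)
Lemma tv_dist_mixture (R : realType) (T : finType) (I : eqType) (s : seq I)
    (p : I -> R) (nu : I -> T -> R) (pi : T -> R) :
    (forall c, 0 <= p c) -> \sum_(c <- s) p c = 1 ->
  tv_dist (fun g => \sum_(c <- s) p c * nu c g) pi <=
  \sum_(c <- s) p c * tv_dist (nu c) pi.
Proof.
move=> p0 p1; rewrite /tv_dist.
have -> : \sum_(c <- s) p c * (2^-1 * \sum_x `|nu c x - pi x|) =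
    2^-1 * \sum_x \sum_(c <- s) p c * `|nu c x - pi x|.
  rewrite exchange_big mulr_sumr; apply: eq_bigr => c _.
  by rewrite mulrCA -mulr_sumr.
rewrite ler_wpM2l ?invr_ge0// ler_sum// => x _.
rewrite -[X in _ - X]mul1r -[X in _ - X * _]p1 mulr_suml -sumrB.
rewrite (le_trans (ler_norm_sum _ _ _))// ler_sum// => c _.
by rewrite -mulrBr normrM ger0_norm.
Qed.

Lemma ln2_ge (R : realType) : 2^-1 <= ln (2 : R).
Proof.
rewrite -ler_expR lnK ?posrE// -[leRHS]invrK.
have := expR_ge1Dx (- 2^-1 : R); rewrite expRN => h.
rewrite -lef_pV2 ?posrE ?invr_gt0 ?expR_gt0// invrK.
by lra.
Qed.

Section Mixing.
Context d (Omega : measurableType d) (R : realType) (Pr : probability Omega R).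
Variables (gT : finGroupType) (mu : gT -> R) (alpha : R) (S : nat -> Omega -> gT).
Local Notation P := (transition_mx mu).
Local Notation gamma := (absolute_gap P).

(** The ratio theta = 1 - gamma / 2 replaces lambda_star so that
    theta >= 1/2, as the recursion on genealogies requires; this costs a factor
    2 in the rate. *)
Lemma srrw_tv_bound M : 0 <= alpha < 1 -> is_pmf mu -> irreducible_mx P ->
    aperiodic_mx P -> symmetric_pmf mu -> is_srrw Pr mu alpha S ->
  tv_dist (law Pr (S M.+1)) (@uniform_pmf R gT) <=
  #|gT|%:R / 2 * expR (1 - (1 - alpha) * gamma / 8 * M.+1%:R).
Proof.
move=> /andP[al0 al1] mu_pmf irr aper mu_sym [xi [u [eta [X [rand X1 XS S0 SS]]]]].
have Pge0 := transition_ge0 mu_pmf; have Pcol := transition_col mu_pmf.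
have Psym := transition_sym mu_sym.
have lam0 := lambda_star_ge0 Pge0 Pcol aper Psym.
have lam1 := lambda_star_lt1 Pge0 Pcol aper Psym.
have contract := sqnorm_contract Pge0 Pcol irr aper Psym.
set lam := lambda_star P in lam0 lam1 contract *.
rewrite /absolute_gap -/lam; pose theta := 1 - (1 - lam) / 2.
have th1 : 2^-1 <= theta by rewrite /theta; lra.
have th2 : theta <= 1 by rewrite /theta; lra.
have lam_th : lam <= theta by rewrite /theta; lra.
have -> : law Pr (S M.+1) = (fun g => \sum_(c <- genealogies M)
    genealogy_weight alpha c * word_law mu (labels M c) g).
  by apply: funext => g; exact: (srrw_law rand X1 XS S0 SS).
have w0 c : 0 <= genealogy_weight alpha c by apply: genealogy_weight_ge0 => //; exact: ltW.
have w1 : \sum_(c <- genealogies M) genealogy_weight alpha c = 1.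
  rewrite -[RHS](genealogy_mean1 alpha M M); apply: eq_bigr => c _.
  by rewrite mulr1.
apply: le_trans (tv_dist_mixture _ _ w0 w1) _.
apply: (@le_trans _ _ (#|gT|%:R / 2 *
    genealogy_mean alpha M (fun r : seq 'I_M.+1 => theta ^+ singletons r))).
  rewrite /genealogy_mean mulr_sumr ler_sum// => c _; rewrite [leRHS]mulrCA.
  rewrite ler_wpM2l// (le_trans (word_law_near_uniform mu_pmf lam0 contract _))//.
  by rewrite ler_wpM2l ?divr_ge0// lerXn2r ?nnegrE// (le_trans lam0).
rewrite ler_wpM2l ?divr_ge0//.
apply: le_trans (genealogy_mean_singletons al0 (ltW al1) th1 th2 (leqnn M)) _.
by rewrite ler_expR /theta; lra.
Qed.
End Mixing.

Theorem proposition1p8 (R : realType) :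
  exists C : R, 0 < C /\
    forall (gT : finGroupType) (alpha : R) (mu : gT -> R),
      (2 <= #|gT|)%N ->
      0 <= alpha < 1 ->
      is_pmf mu ->
      irreducible_mx (transition_mx mu) ->
      aperiodic_mx (transition_mx mu) ->
      symmetric_pmf mu ->
      forall (d : measure_display) (Omega : measurableType d)
        (Pr : probability Omega R) (S : nat -> Omega -> gT),
        is_srrw Pr mu alpha S ->
        forall eps : R, 0 < eps < 1 ->
          (mixing_time Pr S eps <=
            (C / (1 - alpha) * ln (#|gT|%:R / eps)
              * (absolute_gap (transition_mx mu))^-1)%:E)%E.
Proof.
exists 48; split => // gT alpha mu G2 al mu_pmf irr aper mu_sym d Omega Pr S srrw.
move=> eps /andP[eps0 eps1]; have /andP[al0 al1] := al.
have Pge0 := transition_ge0 mu_pmf; have Pcol := transition_col mu_pmf.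
have Psym := transition_sym mu_sym.
have lam0 := lambda_star_ge0 Pge0 Pcol aper Psym.
have lam1 := lambda_star_lt1 Pge0 Pcol aper Psym.
have tv M := srrw_tv_bound M al mu_pmf irr aper mu_sym srrw.
move: tv; rewrite /absolute_gap; set gamma := 1 - lambda_star _ => tv.
have gamma0 : 0 < gamma by rewrite subr_gt0.
have gamma1 : gamma <= 1 by rewrite gerBl.
set n : R := #|gT|%:R in tv *; have n2 : 2 <= n by rewrite ler_nat.
set L := ln (n / eps).
have n_eps : 2 <= n / eps by rewrite ler_pdivlMr//; nra.
have L_ge : 2^-1 <= L.
  by rewrite (le_trans (ln2_ge R))// ler_ln ?posrE//; lra.
(* The bound on the distance is at most eps as soon as b * n / 8 >= L + 1,
   and L + 1 <= 3 * L; the first integer beyond 24 * L / b is at most twice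
   this number, which is at least 1. *)
pose b := (1 - alpha) * gamma.
have b0 : 0 < b by rewrite mulr_gt0// subr_gt0.
have b1 : b <= 1 by rewrite mulr_ile1 ?(ltW gamma0) ?subr_ge0 ?(ltW al1)// gerBl.
pose B := 24 * L / b.
have B1 : 1 <= B.
  rewrite ler_pdivlMr// mul1r (le_trans b1)//.
  by move: L_ge; clearbody L; lra.
have -> : 48 / (1 - alpha) * L * gamma^-1 = 2 * B.
  by rewrite /B /b; field; rewrite !gt_eqF ?subr_gt0.
pose N := (Num.truncn B).+1.
have BN : B < N%:R by apply: truncnS_gt.
have NB : N%:R <= 2 * B.
  have tB : (Num.truncn B)%:R <= B by rewrite truncn_le (le_trans _ B1).
  by rewrite /N -addn1 natrD mulr2n mulrDl mul1r lerD.
apply: (@le_trans _ _ (N%:R)%:E); last by rewrite lee_fin.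
apply: ereal_inf_lbound; exists N => //; split => // -[|M]; first by [].
move=> NM; apply: le_trans (tv M) _.
have MB : B <= M.+1%:R by rewrite (le_trans (ltW BN))// ler_nat.
have bM : 3 * L <= b / 8 * M.+1%:R.
  have -> : 3 * L = b / 8 * B by rewrite /B; field; rewrite gt_eqF.
  by rewrite ler_wpM2l// divr_ge0// ltW.
have n0 : 0 < n by lra.
apply: (@le_trans _ _ (n / 2 * expR (- L))).
  rewrite ler_wpM2l ?divr_ge0 ?(ltW n0)// ler_expR.
  by move: bM; move: (b / 8 * _) => y; lra.
rewrite expRN lnK ?posrE ?divr_gt0//.
have -> : n / 2 * (n / eps)^-1 = eps / 2 by field; rewrite !gt_eqF.
by lra.
Qed.
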